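(* Let $n\geq 2$ be an integer and let $\mathbb F_n=\Lambda^1(\mathbb R^n)\times\Lambda^2(\mathbb R^n)$ be the free step-two Carnot group of rank $n$. Then $\mathcal A_h(\mathbb F_n)$ and $\oplus_{k=0}^n\Lambda^k(\mathbb R^n)$ are isomorphic as real vector spaces. Namely, a map $f:\mathbb F_n\to\mathbb R$ belongs to $\mathcal A_h(\mathbb F_n)$ if and only if there is $(\eta_0,\dots,\eta_n)\in\oplus_{k=0}^n\Lambda^k(\mathbb R^n)$ (with $\eta_k\in\Lambda^k(\mathbb R^n)$) such that for all $(\theta,\omega)\in\mathbb F_n$, $$f(\theta,\omega)\,dx_1\wedge\cdots\wedge dx_n=\sum_{k=0}^{\lfloor n/2\rfloor}\omega^k\wedge\eta_{n-2k}+\sum_{k=0}^{\lfloor (n-1)/2\rfloor}\theta\wedge\omega^k\wedge\eta_{n-2k-1}.$$ Furthermore, such an $(\eta_0,\dots,\eta_n)$ is unique. More precisely, if $f\in\mathcal A_h(\mathbb F_n)$, then for every $(\theta,\omega)\in\mathbb F_n$ the map $t\in(0,+\infty)\mapsto (f\circ\delta_t)(\theta,\omega)$ is a polynomial of degree $\leq n$, and, writing $f_j(\theta,\omega):=\frac{1}{j!}\frac{d^j}{dt^j}(f\circ\delta_t)(\theta,\omega)\big|_{t=0}$ for its coefficients, we have $$\omega^k\wedge\eta_{n-2k}=f_{2k}(\theta,\omega)\,dx_1\wedge\cdots\wedge dx_n\quad\text{for }k\in\{0,\dots,\lfloor n/2\rfloor\},$$ $$\theta\wedge\omega^k\wedge\eta_{n-2k-1}=f_{2k+1}(\theta,\omega)\,dx_1\wedge\cdots\wedge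 dx_n\quad\text{for }k\in\{0,\dots,\lfloor (n-1)/2\rfloor\}.$$
   Context: $\Lambda^k(\mathbb R^n)$ denotes the space of alternating $k$-linear forms on $\mathbb R^n$, and $(dx_1,\dots,dx_n)$ is a fixed basis of $\Lambda^1(\mathbb R^n)$. The free step-two Carnot group of rank $n$ is $\mathbb F_n:=\Lambda^1(\mathbb R^n)\times\Lambda^2(\mathbb R^n)$ with group law $(\theta,\omega)\cdot(\theta',\omega')=(\theta+\theta',\omega+\omega'+\theta\wedge\theta')$. For $t>0$, $\delta_t(\theta,\omega):=(t\theta,t^2\omega)$. A map $f:\mathbb F_n\to\mathbb R$ is horizontally affine ($h$-affine), written $f\in\mathcal A_h(\mathbb F_n)$, if for all $(\theta,\omega)\in\mathbb F_n$ and $\theta'\in\Lambda^1(\mathbb R^n)$ the map $t\in\mathbb R\mapsto f((\theta,\omega)\cdot(t\theta',0))$ is affine. $\omega^k$ denotes the $k$-th exterior power $\omega\wedge\cdots\wedge\omega$ ($\omega^0=1$), and $\lfloor p\rfloor$ is the integer part of $p$. *)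

(* Defs.v *)
From HB Require Import structures.
From mathcomp Require Import all_boot all_order all_algebra.
From mathcomp Require Import reals.
Set Implicit Arguments. Unset Strict Implicit. Unset Printing Implicit Defensive.
Import Order.TTheory GRing.Theory Num.Theory.
Local Open Scope ring_scope.

Section Ext.
Variables (R : realType) (n : nat).

(* An element of the exterior algebra  (+)_k Lambda^k(R^n): its coefficient
   on dx_{i_1} /\ ... /\ dx_{i_m} (i_1 < ... < i_m) is the value at the set
   {i_1,...,i_m}. *)
Definition ext := {ffun {set 'I_n} -> R}.

Definition eadd (x y : ext) : ext := [ffun S => x S + y S].
Definition escale (c : R) (x : ext) : ext := [ffun S => c * x S].
Definition ezero : ext := [ffun S => 0].
Definition eone : ext := [ffun S : {set 'I_n} => (S == set0)%:R].
Definition dx (i : 'I_n) : ext := [ffun S : {set 'I_n} => (S == [set i])%:R].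
Definition vol : ext := [ffun S : {set 'I_n} => (S == setT)%:R].

Definition homog (k : nat) (x : ext) : Prop := forall S : {set 'I_n}, #|S| <> k -> x S = 0.

(* sign of the shuffle bringing dx_A /\ dx_B to dx_(A u B) *)
Definition wsign (A B : {set 'I_n}) : R :=
  (-1) ^+ #|[set p : 'I_n * 'I_n | (p.1 \in A) && (p.2 \in B) && (p.2 < p.1)%N]|.

Definition wedge (x y : ext) : ext :=
  [ffun S : {set 'I_n} => \sum_(A : {set 'I_n} | A \subset S) wsign A (S :\: A) * x A * y (S :\: A)].

Definition wpow (w : ext) (k : nat) : ext := iter k (wedge w) eone.

Definition esum (m : nat) (F : nat -> ext) : ext := \big[eadd/ezero]_(k < m) F k.

Definition inFn (p : ext * ext) : Prop := homog 1 p.1 /\ homog 2 p.2.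

Definition Fmul (p q : ext * ext) : ext * ext :=
  (eadd p.1 q.1, eadd (eadd p.2 q.2) (wedge p.1 q.1)).

Definition dil (t : R) (p : ext * ext) : ext * ext := (escale t p.1, escale (t ^+ 2) p.2).

Definition h_affine (f : ext * ext -> R) : Prop :=
  forall p theta', inFn p -> homog 1 theta' ->
    exists a b : R, forall t : R, f (Fmul p (escale t theta', ezero)) = a * t + b.

Definition is_eta (eta : nat -> ext) : Prop := forall k, (k <= n)%N -> homog k (eta k).

Definition represents (f : ext * ext -> R) (eta : nat -> ext) : Prop :=
  forall theta omega, inFn (theta, omega) ->
    escale (f (theta, omega)) vol =
    eadd (esum (n./2).+1 (fun k => wedge (wpow omega k) (eta (n - 2 * k)%N)))
         (esum ((n - 1)./2).+1
            (fun k => wedge theta (wedge (wpow omega k) (eta (n - 2 * k - 1)%N)))).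

End Ext.

(* Main.v *)
(* On the group, [f] is h-affine exactly when it is a linear functional composed
   with [Phi (theta, omega) = (1 + theta) * exp omega], an element of the exterior
   algebra: [Phi (p * (v, 0)) = Phi p * (1 + v)] makes such compositions h-affine.
   Conversely, a horizontal line is carried by right translations to a curve on
   which [f] is still affine (lemma [h_affine_regulus]), so the h-affine functions
   are stable under right translations, hence under the difference operators
   [X v f p = f (p * (v, 0)) - f p]. On them these operators anticommute, so
   iterating them on [f] at the unit defines a linear functional [T f] on the
   exterior algebra, and [f = T f \o Phi] because the group is generated by the
   elements [(s dx_i, 0)]. Splitting a functional into its homogeneous parts and
   applying Hodge duality yields the forms [eta_k], and they are unique because
   the values of [Phi] span the exterior algebra. *)
Require Import Defs.
From HB Require Import structures.
From mathcomp Require Import all_boot all_order all_algebra.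
From mathcomp Require Import reals ring lra zify.
Import Order.TTheory GRing.Theory Num.Theory.
Local Open Scope ring_scope.

Set Implicit Arguments.
Unset Strict Implicit.
Unset Printing Implicit Defensive.

(** * The exterior algebra as an associative unital algebra *)

Section ExteriorAlgebra.
Variables (R : realType) (n : nat).
Local Notation E := (ext R n).
Local Notation ws := (@wsign R n).
Implicit Types (x y z : E) (A B C S : {set 'I_n}) (i j : 'I_n).

(** The algebra operations built here and below are convertible to [eadd], [escale] and [wedge], so
    goals stated with the latter become algebra goals without rewriting. *)
HB.instance Definition _ := GRing.Zmodule.copy E {ffun {set 'I_n} -> R}.

Fact escaleA (a b : R) x : escale a (escale b x) = escale (a * b) x.
Proof. by apply/ffunP=> S; rewrite !ffunE mulrA. Qed.
Fact escale1 : left_id 1 (@escale R n).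
Proof. by move=> x; apply/ffunP=> S; rewrite !ffunE mul1r. Qed.
Fact escaleDr : right_distributive (@escale R n) +%R.
Proof. by move=> a x y; apply/ffunP=> S; rewrite !ffunE mulrDr. Qed.
Fact escaleDl x : {morph (@escale R n)^~ x : a b / a + b}.
Proof. by move=> a b; apply/ffunP=> S; rewrite !ffunE mulrDl. Qed.
HB.instance Definition _ := GRing.Zmodule_isLmodule.Build R E
  escaleA escale1 escaleDr escaleDl.

Definition invs A B :=
  [set p : 'I_n * 'I_n | (p.1 \in A) && (p.2 \in B) && (p.2 < p.1)%N].

Lemma wsign_U1 A B C : [disjoint A & B] -> ws (A :|: B) C = ws A C * ws B C.
Proof.
move=> dAB; rewrite /wsign -exprD -!/(invs _ _); congr (_ ^+ _).
have -> : invs (A :|: B) C = invs A C :|: invs B C.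
  by apply/setP=> p; rewrite !inE !andb_orl.
rewrite cardsU; suff -> : invs A C :&: invs B C = set0 by rewrite cards0 subn0.
apply/setP=> p; rewrite !inE; apply/negP=> /andP[/andP[/andP[pA _] _]].
by rewrite (disjointFr dAB pA).
Qed.

Lemma wsign_U2 A B C : [disjoint B & C] -> ws A (B :|: C) = ws A B * ws A C.
Proof.
move=> dBC; rewrite /wsign -exprD -!/(invs _ _); congr (_ ^+ _).
have -> : invs A (B :|: C) = invs A B :|: invs A C.
  by apply/setP=> p; rewrite !inE !andb_orr !andb_orl.
rewrite cardsU; suff -> : invs A B :&: invs A C = set0 by rewrite cards0 subn0.
apply/setP=> p; rewrite !inE; apply/negP=> /andP[/andP[/andP[_ pB] _]].
by rewrite (disjointFr dBC pB) !andbF.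
Qed.

(** Structure constants of the wedge product in the basis [dxs]. Letting A and B range over all sets
    makes the sums freely exchangeable. *)
Definition wcoef A B S : R :=
  if [disjoint A & B] && (A :|: B == S) then ws A B else 0.

Lemma wedgeE x y S : wedge x y S = \sum_A \sum_B wcoef A B S * x A * y B.
Proof.
rewrite ffunE [LHS]big_mkcond; apply: eq_bigr => A _.
(* Given A, only B = S \ A can contribute. *)
rewrite (bigD1 (S :\: A)) //= big1 => [|B neB].
  rewrite /wcoef addr0.
  have -> : [disjoint A & S :\: A].
    by rewrite -setI_eq0; apply/eqP/setP => i; rewrite !inE; case: (i \in A).
  rewrite setDE setUIr setUCr setIT; case: ifPn => sAS.
    by rewrite -setDE (setUidPr sAS) eqxx.
  case: eqP => [AS|_]; last by rewrite !mul0r.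
  by case/negP: sAS; rewrite -AS subsetUl.
rewrite /wcoef; case: ifP => [/andP[dAB /eqP US]|_]; last by rewrite !mul0r.
case/eqP: neB; apply/setP=> i; rewrite -US !inE.
by case iA: (i \in A); rewrite //= (disjointFr dAB iA).
Qed.

(** Each side has at most one nonzero term. Both equal [ws A B * ws A C * ws B C] if A, B, C are
    pairwise disjoint with union S, and vanish otherwise. *)
Lemma wcoef_assoc A B C S :
  \sum_D wcoef A B D * wcoef D C S = \sum_D wcoef B C D * wcoef A D S.
Proof.
rewrite (bigD1 (A :|: B)) //= big1 ?addr0; last first.
  by move=> D /negbTE nD; rewrite /wcoef eq_sym nD andbF mul0r.
rewrite [RHS](bigD1 (B :|: C)) //= [X in _ = _ + X]big1 ?addr0; last first.
  by move=> D /negbTE nD; rewrite /wcoef [B :|: C == D]eq_sym nD andbF mul0r.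
rewrite /wcoef !eqxx !andbT setUA.
have dU1 : [disjoint A :|: B & C] = [disjoint A & C] && [disjoint B & C].
  by rewrite -!setI_eq0 setIUl setU_eq0.
have dU2 : [disjoint A & B :|: C] = [disjoint A & B] && [disjoint A & C].
  by rewrite -!setI_eq0 setIUr setU_eq0.
rewrite dU1 dU2.
case dAB: [disjoint A & B]; case dAC: [disjoint A & C];
  case dBC: [disjoint B & C]; rewrite /= ?mul0r ?mulr0 //.
case: eqP => _; rewrite ?mulr0 //.
by rewrite wsign_U1 // wsign_U2 // mulrA mulrC mulrA.
Qed.

Fact wedgeA : associative (@wedge R n).
Proof.
move=> x y z; apply/ffunP=> S; rewrite wedgeE [RHS]wedgeE.
transitivity (\sum_A \sum_B \sum_C (\sum_D wcoef A B D * wcoef D C S)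
                * (x A * y B * z C)).
  apply: eq_bigr => A _; under [RHS]eq_bigr => B _ do
    under eq_bigr => C _ do rewrite wcoef_assoc mulr_suml.
  under [LHS]eq_bigr => D _.
    rewrite wedgeE mulr_sumr; under eq_bigr => B _ do rewrite mulr_sumr.
    over.
  rewrite exchange_big; apply: eq_bigr => B _.
  rewrite exchange_big; apply: eq_bigr => C _.
  by apply: eq_bigr => D _; ring.
transitivity (\sum_D \sum_C \sum_A \sum_B
                wcoef A B D * wcoef D C S * (x A * y B * z C)).
  rewrite [RHS]exchange_big /=; under [RHS]eq_bigr => C _ do
    rewrite exchange_big /=.
  rewrite [RHS]exchange_big /=; apply: eq_bigr => A _.
  under [RHS]eq_bigr => C _ do rewrite exchange_big /=.
  rewrite [RHS]exchange_big /=; apply: eq_bigr => B _.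
  by apply: eq_bigr => C _; rewrite mulr_suml.
apply: eq_bigr => D _; apply: eq_bigr => C _.
rewrite wedgeE mulr_sumr mulr_suml; apply: eq_bigr => A _.
by rewrite mulr_sumr mulr_suml; apply: eq_bigr => B _; ring.
Qed.

Lemma wsign0l A : ws set0 A = 1.
Proof.
rewrite /wsign; have -> : [set p : 'I_n * 'I_n | (p.1 \in set0) && (p.2 \in A)
  && (p.2 < p.1)%N] = set0 by apply/setP=> p; rewrite !inE.
by rewrite cards0 expr0.
Qed.

Lemma wsign0r A : ws A set0 = 1.
Proof.
rewrite /wsign; have -> : [set p : 'I_n * 'I_n | (p.1 \in A) && (p.2 \in set0)
  && (p.2 < p.1)%N] = set0 by apply/setP=> p; rewrite !inE andbF.
by rewrite cards0 expr0.
Qed.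

Fact wedge1x : left_id (eone R n) (@wedge R n).
Proof.
move=> x; apply/ffunP=> S; rewrite ffunE (bigD1 set0) ?sub0set //= big1.
  by rewrite ffunE eqxx setD0 wsign0l !mul1r addr0.
by move=> A /andP[_ /negbTE nA]; rewrite ffunE nA mulr0 mul0r.
Qed.

Fact wedgex1 : right_id (eone R n) (@wedge R n).
Proof.
move=> x; apply/ffunP=> S; rewrite ffunE (bigD1 S) //= big1.
  by rewrite setDv ffunE eqxx wsign0r mulr1 mul1r addr0.
move=> A /andP[sAS nA]; rewrite ffunE setD_eq0.
case: (boolP (S \subset A)) => [sSA|]; last by rewrite mulr0.
by rewrite eqEsubset sAS sSA in nA.
Qed.

Fact wedgeDl : left_distributive (@wedge R n) +%R.
Proof.
move=> x y z; apply/ffunP=> S; rewrite !ffunE -big_split.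
by apply: eq_bigr => A _ /=; rewrite !ffunE; ring.
Qed.

Fact wedgeDr : right_distributive (@wedge R n) +%R.
Proof.
move=> x y z; apply/ffunP=> S; rewrite !ffunE -big_split.
by apply: eq_bigr => A _ /=; rewrite !ffunE; ring.
Qed.

Fact eone_neq0 : eone R n != 0.
Proof. by apply/eqP=> /ffunP/(_ set0)/eqP; rewrite !ffunE eqxx oner_eq0. Qed.

HB.instance Definition _ := GRing.Zmodule_isNzRing.Build E
  wedgeA wedge1x wedgex1 wedgeDl wedgeDr eone_neq0.

Fact escaleAl (a : R) x y : a *: (x * y) = (a *: x) * y.
Proof.
apply/ffunP=> S; rewrite !ffunE mulr_sumr; apply: eq_bigr => A _.
by rewrite ffunE; ring.
Qed.
HB.instance Definition _ := GRing.Lmodule_isLalgebra.Build R E escaleAl.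

Fact escaleAr (a : R) x y : a *: (x * y) = x * (a *: y).
Proof.
apply/ffunP=> S; rewrite !ffunE mulr_sumr; apply: eq_bigr => A _.
by rewrite ffunE; ring.
Qed.
HB.instance Definition _ := GRing.Lalgebra_isAlgebra.Build R E escaleAr.

Lemma extD x y S : (x + y) S = x S + y S. Proof. by rewrite ffunE. Qed.
Lemma extN x S : (- x) S = - x S. Proof. by rewrite ffunE. Qed.
Lemma extZ (a : R) x S : (a *: x) S = a * x S. Proof. by rewrite ffunE. Qed.
Lemma ext0 S : (0 : E) S = 0. Proof. by rewrite ffunE. Qed.
Lemma ext_sum (I : Type) (r : seq I) (P : pred I) (F : I -> E) S :
  (\sum_(i <- r | P i) F i) S = \sum_(i <- r | P i) F i S.
Proof. by elim/big_rec2: _ => [|i _ y _ <-]; rewrite ?ext0 ?extD. Qed.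
Definition extlE := (extD, extN, extZ, ext0).

Lemma wpowE x k : wpow x k = x ^+ k.
Proof. by elim: k => // k IH; rewrite exprS -IH. Qed.

Lemma esumE m (F : nat -> E) : esum m F = \sum_(k < m) F k.
Proof. by []. Qed.

Lemma mulE x y S : (x * y) S = \sum_A \sum_B wcoef A B S * x A * y B.
Proof. exact: wedgeE. Qed.

(** * The monomial basis, the grading and the commutation rules *)

Definition dxs A : E := [ffun S => (S == A)%:R].

Lemma dxsE A S : dxs A S = (S == A)%:R. Proof. by rewrite ffunE. Qed.

Lemma ext_dxs x : x = \sum_S x S *: dxs S.
Proof.
apply/ffunP=> S; rewrite ext_sum (bigD1 S) //= big1 => [|A nA].
  by rewrite extZ dxsE eqxx mulr1 addr0.
by rewrite extZ dxsE eq_sym (negbTE nA) mulr0.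
Qed.

Lemma dxs0 : dxs set0 = 1. Proof. by []. Qed.

Lemma dxsM A B : dxs A * dxs B =
  if [disjoint A & B] then ws A B *: dxs (A :|: B) else 0.
Proof.
apply/ffunP=> S; rewrite mulE (bigD1 A) //= [X in _ + X]big1 ?addr0; last first.
  by move=> A' /negbTE nA; apply: big1 => B' _; rewrite dxsE nA mulr0 mul0r.
rewrite (bigD1 B) //= [X in _ + X]big1 ?addr0; last first.
  by move=> B' /negbTE nB; rewrite [dxs B B']dxsE nB mulr0.
rewrite !dxsE !eqxx !mulr1 /wcoef.
case: ifP => [/andP[-> /eqP<-]|]; first by rewrite extZ dxsE eqxx mulr1.
case: ifP => _ /=; last by rewrite ext0.
by rewrite extZ dxsE eq_sym => ->; rewrite mulr0.
Qed.

Lemma homog0 k : homog k (0 : E). Proof. by move=> S _; rewrite ext0. Qed.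
Lemma homogD k x y : homog k x -> homog k y -> homog k (x + y).
Proof. by move=> hx hy S nS; rewrite extD hx ?hy ?addr0. Qed.
Lemma homogZ k (a : R) x : homog k x -> homog k (a *: x).
Proof. by move=> hx S nS; rewrite extZ hx ?mulr0. Qed.
Lemma homogN k x : homog k x -> homog k (- x).
Proof. by rewrite -scaleN1r; exact: homogZ. Qed.
Lemma homog1 : homog 0 (1 : E).
Proof. by move=> S; rewrite -dxs0 dxsE; case: eqP => // ->; rewrite cards0. Qed.
Lemma homogM k l x y : homog k x -> homog l y -> homog (k + l) (x * y).
Proof.
move=> hx hy S nS; rewrite mulE; apply: big1 => A _; apply: big1 => B _.
rewrite /wcoef; case: ifP => [/andP[dAB /eqP US]|_]; last by rewrite !mul0r.
case: (#|A| =P k) => [kA|/hx->]; last by rewrite mulr0 mul0r.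
rewrite hy ?mulr0 // => lB; case: nS.
by rewrite -US cardsU disjoint_setI0 // cards0 subn0 kA lB.
Qed.
Lemma homogX k x m : homog k x -> homog (k * m) (x ^+ m).
Proof.
move=> hx; elim: m => [|m IH]; first by rewrite muln0; exact: homog1.
by rewrite mulnS exprS; exact: homogM.
Qed.
Lemma homog_gt k x : (n < k)%N -> homog k x -> x = 0.
Proof.
move=> nk hx; apply/ffunP=> S; rewrite ext0 hx // => cS.
by have := max_card (mem S); rewrite card_ord cS leqNgt nk.
Qed.
Lemma homog_dxs A : homog #|A| (dxs A).
Proof. by move=> S nS; rewrite dxsE; case: eqP => // SA; rewrite SA in nS. Qed.
Lemma homog_dx i : homog 1 (dx R i).
Proof. by have := @homog_dxs [set i]; rewrite cards1. Qed.

Lemma vol_homog x : homog n x -> x = x setT *: vol R n.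
Proof.
move=> hx; apply/ffunP=> S; rewrite extZ [vol _ _ _]ffunE.
case: eqP => [->|/eqP nS]; first by rewrite mulr1.
rewrite mulr0 hx // => cS; case/negP: nS.
by rewrite eqEcard subsetT cS cardsT card_ord leqnn.
Qed.

Lemma dxs1 i : dxs [set i] = dx R i. Proof. by []. Qed.

Lemma homog1E x : homog 1 x -> x = \sum_i x [set i] *: dx R i.
Proof.
move=> hx; apply/ffunP=> S; rewrite ext_sum.
have [/cards1P[j ->]|/eqP nS] := boolP (#|S| == 1%N).
  rewrite (bigD1 j) //= big1 => [|i nij].
    by rewrite extZ -dxs1 dxsE eqxx mulr1 addr0.
  by rewrite extZ -dxs1 dxsE (inj_eq set1_inj) eq_sym (negbTE nij) mulr0.
rewrite hx // big1 // => i _; rewrite extZ -dxs1 dxsE.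
by case: eqP => [Si|]; [rewrite Si cards1 in nS | rewrite mulr0].
Qed.

Lemma dxs2 i j : i != j ->
  dxs [set i; j] = ws [set i] [set j] *: (dx R i * dx R j).
Proof.
move=> nij; rewrite -!dxs1 dxsM disjoints1 inE nij scalerA -expr2 sqrr_sign.
by rewrite scale1r.
Qed.

(** For distinct indices exactly one of (i, j) and (j, i) is an inversion; for equal ones both
    products vanish. *)
Lemma dx_anticomm i j : dx R i * dx R j = - (dx R j * dx R i).
Proof.
rewrite -!dxs1 !dxsM disjoint_sym [[set j] :|: _]setUC.
case: ifP; last by rewrite oppr0.
rewrite disjoints1 inE => nij; rewrite -scaleNr; congr (_ *: _).
have w1 (a b : 'I_n) : ws [set a] [set b] = (-1) ^+ (b < a)%N.
  rewrite /wsign; case: ltnP => ba.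
    rewrite (_ : [set p | _] = [set (a, b)]) ?cards1 //.
    apply/setP=> -[c d]; rewrite !inE xpair_eqE /=.
    by case: eqP => //= ->; case: eqP => //= ->.
  rewrite (_ : [set p | _] = set0) ?cards0 //.
  apply/setP=> -[c d]; rewrite !inE /=.
  by case: eqP => //= ->; case: eqP => //= ->; rewrite ltnNge ba.
rewrite !w1; case: ltngtP => [_|_|ij]; rewrite ?expr0 ?expr1 ?opprK //.
by rewrite (val_inj ij) eqxx in nij.
Qed.

Lemma anticomm1 x y : homog 1 x -> homog 1 y -> x * y = - (y * x).
Proof.
move=> /homog1E-> /homog1E->; rewrite mulr_suml mulr_sumr -sumrN.
apply: eq_bigr => i _; rewrite mulr_sumr mulr_suml -sumrN.
apply: eq_bigr => j _.
by rewrite -!scalerAl -!scalerAr dx_anticomm !scalerN !scalerA mulrC.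
Qed.

Lemma sqr1 x : homog 1 x -> x * x = 0.
Proof.
move=> hx; apply/ffunP=> S; rewrite ext0; apply/eqP.
have /ffunP/(_ S)/eqP := anticomm1 hx hx.
by rewrite extN -addr_eq0 -mulr2n mulrn_eq0.
Qed.

(** No element of A exceeds i, so [A :\ i] followed by i has no inversion. This peels off the last
    factor in the induction of [Phi_total]. *)
Lemma dxs_max A i : i \in A -> (forall j, j \in A -> (j <= i)%N) ->
  dxs A = dxs (A :\ i) * dx R i.
Proof.
move=> iA mA; rewrite -dxs1 dxsM disjoint_sym disjoints1 !inE eqxx /=.
rewrite setUC setD1K // /wsign (_ : [set p | _] = set0) ?cards0 ?scale1r //.
apply/setP=> -[c d]; rewrite !inE /=; apply/negP.
by move=> /andP[/andP[/andP[_ /mA ci] /eqP->]]; rewrite ltnNge ci.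
Qed.

(** A 2-form is a combination of products of two one-forms, and moving a one-form past such a
    product changes the sign twice. *)
Lemma comm_homog2_1 x y : homog 2 x -> homog 1 y -> GRing.comm y x.
Proof.
move=> hx hy; rewrite [x]ext_dxs; apply: commr_sum => A _.
have [cA|/eqP nA] := boolP (#|A| == 2); last first.
  by rewrite (hx _ nA) scale0r; exact: commr0.
case/cards2P: cA => i [j [nij ->]]; rewrite dxs2 //.
rewrite /GRing.comm -!scalerAr -!scalerAl mulrA (anticomm1 hy (@homog_dx i)).
by rewrite mulNr -mulrA (anticomm1 hy (@homog_dx j)) mulrN opprK mulrA.
Qed.

Lemma comm_homog2 x y : homog 2 x -> homog 2 y -> GRing.comm y x.
Proof.
move=> hx hy; apply: commr_sym; rewrite [y]ext_dxs; apply: commr_sum => A _.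
have [cA|/eqP nA] := boolP (#|A| == 2); last first.
  by rewrite (hy _ nA) scale0r; exact: commr0.
case/cards2P: cA => i [j [nij ->]]; rewrite dxs2 //.
have /(_ _)/commr_sym C k := comm_homog2_1 hx (@homog_dx k).
rewrite /GRing.comm -!scalerAr -!scalerAl; congr (_ *: (_ *: _)).
exact: commrM.
Qed.

End ExteriorAlgebra.

(** * The group law, horizontal lines and difference operators *)

Section HorizontallyAffine.
Variables (R : realType) (n : nat).
Local Notation E := (ext R n).
Local Notation ws := (@wsign R n).
Local Notation e := (dx R).
Implicit Types (x y v w : E) (A B S : {set 'I_n}) (i j : 'I_n).
Implicit Types (p q : E * E) (f g : E * E -> R) (l : seq 'I_n).

Definition ex v : E * E := (v, 0).
Definition Fone : E * E := (0, 0).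

Lemma FmulE p q : Fmul p q = (p.1 + q.1, p.2 + q.2 + p.1 * q.1).
Proof. by []. Qed.

Lemma FmulA p q (r : E * E) : Fmul (Fmul p q) r = Fmul p (Fmul q r).
Proof.
rewrite !FmulE /= !mulrDl !mulrDr; congr pair;
by apply/ffunP=> S; rewrite !extlE; ring.
Qed.

Lemma Fmulp1 p : Fmul p Fone = p.
Proof. by rewrite FmulE /= mulr0 !addr0; case: p. Qed.

Lemma Fmul1p p : Fmul Fone p = p.
Proof. by rewrite FmulE /= mul0r addr0 !add0r; case: p. Qed.

Lemma inFn_mul p q : inFn p -> inFn q -> inFn (Fmul p q).
Proof.
move=> [p1 p2] [q1 q2]; split; first exact: homogD.
by apply: homogD; [exact: homogD | exact: (homogM p1 q1)].
Qed.

Lemma inFn_ex v : homog 1 v -> inFn (ex v).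
Proof. by move=> hv; split => //; exact: homog0. Qed.

Lemma inFn1 : inFn Fone. Proof. by split; exact: homog0. Qed.

Lemma inFn_mulex p v : inFn p -> homog 1 v -> inFn (Fmul p (ex v)).
Proof. by move=> hp hv; apply: inFn_mul => //; exact: inFn_ex. Qed.

Definition X v f p : R := f (Fmul p (ex v)) - f p.

(** An affine function is determined by its values at t = 0 and t = 1. *)
Lemma h_affine_line f p v (t : R) : h_affine f -> inFn p -> homog 1 v ->
  f (Fmul p (ex (t *: v))) = f p + t * X v f p.
Proof.
move=> hf hp hv; have [a [b H]] := hf p v hp hv.
rewrite -[ex (t *: v)]/(escale t v, ezero R n) H /X.
have := H 0; have := H 1.
rewrite -[escale 1 v]/(1 *: v) -[escale 0 v]/(0 *: v) scale1r scale0r.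
rewrite -[(0, _)]/Fone Fmulp1 -[(v, _)]/(ex v) => -> ->; ring.
Qed.

Lemma h_affineB f g : h_affine f -> h_affine g -> h_affine (fun p => f p - g p).
Proof.
move=> hf hg p v hp hv; have [a [b H]] := hf p v hp hv.
have [a' [b' H']] := hg p v hp hv.
by exists (a - a'), (b - b') => t; rewrite H H'; ring.
Qed.

(* The points [exp(sv) exp(w)] lie on horizontal lines meeting the two
   horizontal lines [exp(2w) exp(-3sv)] and [exp(w/2) exp(3sv)], and divide the
   segments between them in a ratio which does not depend on [s]. *)
Lemma h_affine_regulus f p v w (s : R) :
  h_affine f -> inFn p -> homog 1 v -> homog 1 w ->
  f (Fmul (Fmul p (ex (s *: v))) (ex w)) =
    3^-1 * f (Fmul (Fmul p (ex (2 *: w))) (ex (((- 3) * s) *: v)))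
    + 2 / 3 * f (Fmul (Fmul p (ex (2^-1 *: w))) (ex ((3 * s) *: v))).
Proof.
move=> hf hp hv hw; set P := Fmul (Fmul p (ex (s *: v))) (ex w).
(* [u] directs the line through [P] that meets the two other lines at parameters 1 and -1/2; the
   weights 1/3 and 2/3 make the mean parameter 0, that of [P]. *)
pose u := w + (- 4 * s) *: v.
have hu : homog 1 u by apply: homogD => //; exact: homogZ.
have hP : inFn P by do 2!apply: inFn_mulex => //; exact: homogZ.
have vv := sqr1 hv; have ww := sqr1 hw; have wv := anticomm1 hw hv.
have E1 : Fmul P (ex (1 *: u)) =
    Fmul (Fmul p (ex (2 *: w))) (ex (((- 3) * s) *: v)).
  rewrite /P /u !FmulE /= !(mulrDl, mulrDr, scalerDr, addr0).
  rewrite -!(scalerAl, scalerAr) vv ww wv; congr pair;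
  by apply/ffunP=> S; rewrite !extlE; ring.
have E2 : Fmul P (ex ((- 2^-1) *: u)) =
    Fmul (Fmul p (ex (2^-1 *: w))) (ex ((3 * s) *: v)).
  rewrite /P /u !FmulE /= !(mulrDl, mulrDr, scalerDr, addr0).
  rewrite -!(scalerAl, scalerAr) vv ww wv; congr pair;
  by apply/ffunP=> S; rewrite !extlE; field.
by rewrite -E1 -E2 !h_affine_line //; field.
Qed.

(** The vertical factor [(0, q.2)] is central and is absorbed into p. By [h_affine_regulus], f on
    the translated line is then a fixed combination of its values on two horizontal lines through
    points independent of t. *)
Lemma h_affine_right f q : h_affine f -> inFn q ->
  h_affine (fun p => f (Fmul p q)).
Proof.
move=> hf [hw hom] p v hp hv; set w := q.1 in hw; set om := q.2 in hom.
pose p' := Fmul p (0, om).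
have hp' : inFn p' by apply: inFn_mul => //; split => //; exact: homog0.
have h2 : inFn (Fmul p' (ex (2 *: w))) by apply/inFn_mulex/homogZ.
have h3 : inFn (Fmul p' (ex (2^-1 *: w))) by apply/inFn_mulex/homogZ.
(* The slopes have factors (1/3) (-3) = -1 and (2/3) 3 = 2. *)
exists (- X v f (Fmul p' (ex (2 *: w))) + 2 * X v f (Fmul p' (ex (2^-1 *: w)))).
exists (3^-1 * f (Fmul p' (ex (2 *: w)))
        + 2 / 3 * f (Fmul p' (ex (2^-1 *: w)))) => t.
rewrite -[(escale t v, ezero R n)]/(ex (t *: v)).
have -> : Fmul (Fmul p (ex (t *: v))) q =
    Fmul (Fmul p' (ex (t *: v))) (ex w).
  rewrite /p' !FmulE /= !mulr0 !(addr0, add0r); congr pair.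
  by apply/ffunP=> S; rewrite !extlE; ring.
by rewrite h_affine_regulus // !(h_affine_line _ hf _ hv) //; field.
Qed.

Lemma h_affineX v f : h_affine f -> homog 1 v -> h_affine (X v f).
Proof.
move=> hf hv; apply: h_affineB => //; apply: h_affine_right => //.
exact: inFn_ex.
Qed.

Lemma X_sqr v f p : h_affine f -> homog 1 v -> inFn p -> X v (X v f) p = 0.
Proof.
move=> hf hv hp; rewrite {1}/X {1}/X FmulA.
have -> : Fmul (ex v) (ex v) = ex (2 *: v).
  by rewrite FmulE /= sqr1 // !addr0 scaler_nat mulr2n.
by rewrite h_affine_line // /X; ring.
Qed.

(* Compare the terms of degree two in [t] in
   [f(p exp(tv) exp(2tw) exp(tv)) = f(p exp(2t(v+w)))]. *)
Lemma X_anticomm v w f p : h_affine f -> homog 1 v -> homog 1 w -> inFn p ->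
  X v (X w f) p = - X w (X v f) p.
Proof.
move=> hf hv hw hp.
have hvw : homog 1 (v + w) by exact: homogD.
have key (t : R) :
    Fmul (Fmul (Fmul p (ex (t *: v))) (ex ((2 * t) *: w))) (ex (t *: v)) =
    Fmul p (ex ((2 * t) *: (v + w))).
  rewrite !FmulE /= !(mulrDl, mulrDr, scalerDr, addr0).
  rewrite -!(scalerAl, scalerAr) (sqr1 hv) (anticomm1 hw hv); congr pair;
  by apply/ffunP=> S; rewrite !extlE; ring.
have expand (t : R) :
    f p + t * X v f p + (2 * t) * (X w f p + t * X v (X w f) p)
    + t * (X v f p + t * X v (X v f) p
           + (2 * t) * (X w (X v f) p + t * X v (X w (X v f)) p))
    = f p + 2 * t * X (v + w) f p.
  rewrite -[RHS]h_affine_line // -key.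
  have hXv := h_affineX hf hv; have hXw := h_affineX hf hw.
  have hXwv := h_affineX hXv hw.
  have htv : homog 1 (t *: v) by exact: homogZ.
  have htw : homog 1 ((2 * t) *: w) by exact: homogZ.
  rewrite (h_affine_line _ hf _ hv); last by do 2!apply: inFn_mulex => //.
  by rewrite !h_affine_line //; do ?apply: inFn_mulex.
(* Adding the identities at t = 1 and t = -1 cancels the odd powers of t. *)
have := expand 1; have := expand (- 1); rewrite X_sqr //; lra.
Qed.

(** * Iterated differences and the functional they define *)

(** The list fixes the order in which the anticommuting differences are composed; keeping it apart
    from S allows induction on it. *)
Definition D f l S := foldr (fun j g => if j \in S then X (e j) g else g) f l.

Lemma D_cons f j l S :
  D f (j :: l) S = if j \in S then X (e j) (D f l S) else D f l S.
Proof. by []. Qed.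

Lemma D_cat f l1 l2 S : D f (l1 ++ l2) S = D (D f l2 S) l1 S.
Proof. exact: foldr_cat. Qed.

Lemma h_affineD f l S : h_affine f -> h_affine (D f l S).
Proof.
move=> hf; elim: l => //= j l IH; case: ifP => // _.
by apply: h_affineX => //; exact: homog_dx.
Qed.

(** Identities between h-affine functions are known on the group only; they pass through [D] because
    the group is stable under horizontal steps. The case c = 0 yields vanishing. *)
Lemma D_scale (c : R) f g l S :
  (forall p, inFn p -> f p = c * g p) ->
  forall p, inFn p -> D f l S p = c * D g l S p.
Proof.
move=> fg; elim: l => //= j l IH p hp; case: ifP => _; last exact: IH.
by rewrite /X !IH //; [ring | apply/inFn_mulex/homog_dx].
Qed.

Lemma D_eq_in f l S S' : {in l, S =i S'} -> D f l S = D f l S'.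
Proof.
elim: l => //= j l IH H; rewrite IH => [|k kl].
  by rewrite H // mem_head.
by rewrite H // inE kl orbT.
Qed.

Lemma DX_comm i f l S p : h_affine f -> inFn p ->
  D (X (e i) f) l S p = (-1) ^+ count [in S] l * X (e i) (D f l S) p.
Proof.
move=> hf; elim: l p => [|j l IH] p hp /=; first by rewrite mul1r.
case: ifP => jS; rewrite /=; last by rewrite add0n IH.
have hd k : homog 1 (e k) := @homog_dx R n k.
rewrite {1}/X !IH //; last exact: inFn_mulex.
rewrite -mulrBr -/(X (e j) (X (e i) (D f l S)) p) X_anticomm //.
  by rewrite exprS mulN1r mulrN mulNr.
exact: h_affineD.
Qed.

(** The new difference crosses those of [l2] selected by S, at the cost of one sign each, and
    reaches the slot of i. If that slot is already taken, [X_sqr] gives 0. *)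
Lemma DX_in i f l1 l2 S p : h_affine f -> inFn p ->
  i \notin l1 -> i \notin l2 ->
  D (X (e i) f) (l1 ++ i :: l2) S p =
  if i \in S then 0
  else (-1) ^+ count [in S] l2 * D f (l1 ++ i :: l2) (i |: S) p.
Proof.
move=> hf hp il1 il2; rewrite !D_cat !D_cons setU11.
have hd k : homog 1 (e k) := @homog_dx R n k.
have hD : h_affine (D f l2 S) by exact: h_affineD.
case: ifP => iS; last first.
  rewrite [in RHS](@D_eq_in _ l1 _ S); last first.
    by move=> k kl; rewrite !inE; case: eqP => // ki; rewrite -ki kl in il1.
  apply: D_scale => // q hq; rewrite DX_comm // [in RHS](@D_eq_in _ l2 _ S) //.
  by move=> k kl; rewrite !inE; case: eqP => // ki; rewrite -ki kl in il2.
rewrite (@D_scale 0 _ f) ?mul0r // => q hq.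
rewrite mul0r {1}/X !DX_comm //; last exact: inFn_mulex.
by rewrite -mulrBr -/(X (e i) (X (e i) (D f l2 S)) q) X_sqr ?mulr0.
Qed.

(** The enumeration is increasing, so the inversions between S and i are the members of S in [l2].
    Hence the sign in [DX_in] is that of the wedge product. *)
Lemma wsign_enum i l1 l2 S : enum 'I_n = l1 ++ i :: l2 ->
  ws S [set i] = (-1) ^+ count [in S] l2.
Proof.
move=> el; rewrite /wsign; congr (_ ^+ _).
have : pairwise (fun a b : 'I_n => (a < b)%N) (enum 'I_n).
  by rewrite -(pairwise_map val ltn) val_enum_ord -sorted_pairwise
    ?iota_ltn_sorted //; exact: ltn_trans.
rewrite el pairwise_cat allrel_consr /=.
move=> /and3P[/andP[/allP l1i _] _ /andP[/allP l2i _]].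
transitivity #|[set a in S | (i < a)%N]|.
  have pair_inj : injective (fun a : 'I_n => (a, i)) by move=> a b [].
  rewrite -(card_imset _ pair_inj).
  apply: eq_card => -[a b]; apply/idP/imsetP.
    rewrite !inE /= => /andP[/andP[aS /eqP->] ia].
    by exists a; rewrite ?inE ?aS.
  by case=> c; rewrite !inE => /andP[cS ic] [-> ->]; rewrite cS eqxx.
rewrite cardE /enum_mem -enumT size_filter el count_cat /= !inE.
rewrite ltnn andbF add0n.
rewrite (@eq_in_count _ _ pred0 l1) ?count_pred0 ?add0n; last first.
  by move=> a /l1i ai; rewrite /= !inE ltnNge ltnW ?andbF.
by apply: eq_in_count => a /l2i ia; rewrite /= !inE ia andbT.
Qed.

Definition T f x : R := \sum_S x S * D f (enum 'I_n) S Fone.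

Lemma enum_split i : exists l1 l2,
  [/\ i \notin l1, i \notin l2 & enum 'I_n = l1 ++ i :: l2].
Proof.
have iE : i \in enum 'I_n by rewrite mem_enum.
have := enum_uniq 'I_n; case/path.splitPr: iE => l1 l2.
rewrite cat_uniq /= negb_or => /and3P[_ /andP[il1 _] /andP[il2 _]].
by exists l1, l2.
Qed.

(** On monomials, [dxs A * e i] is 0 or a signed [dxs (i |: A)], and [DX_in] gives the same
    alternative with the same sign. *)
Lemma T_X i f x : h_affine f -> T (X (e i) f) x = T f (x * e i).
Proof.
move=> hf; rewrite /T.
under [RHS]eq_bigr => S _ do rewrite mulE mulr_suml.
rewrite [RHS]exchange_big; apply: eq_bigr => A _ /=.
have -> : \sum_S (\sum_B wcoef R A B S * x A * e i B) * D f (enum 'I_n) S Fone =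
    \sum_S wcoef R A [set i] S * x A * D f (enum 'I_n) S Fone.
  apply: eq_bigr => S _; rewrite (bigD1 [set i]) //= big1 => [|B nB].
    by rewrite -dxs1 dxsE eqxx mulr1 addr0.
  by rewrite -dxs1 dxsE (negbTE nB) mulr0.
have [l1 [l2 [il1 il2 el]]] := enum_split i.
rewrite (bigD1 (A :|: [set i])) //= big1 => [|S nS]; last first.
  by rewrite /wcoef eq_sym (negbTE nS) andbF !mul0r.
rewrite addr0 /wcoef eqxx andbT disjoint_sym disjoints1 el DX_in //; last first.
  exact: inFn1.
case: ifP => iA; first by rewrite !(mul0r, mulr0).
by rewrite (wsign_enum A el) setUC -el /=; ring.
Qed.

Lemma T_lin f (a : R) x y : T f (a *: x + y) = a * T f x + T f y.
Proof.
rewrite /T mulr_sumr -big_split; apply: eq_bigr => S _ /=.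
by rewrite !extlE; ring.
Qed.

Lemma T1 f : T f 1 = f Fone.
Proof.
rewrite /T -dxs0 (bigD1 set0) //= big1 => [|S nS]; last first.
  by rewrite dxsE (negbTE nS) mul0r.
rewrite dxsE eqxx mul1r addr0; elim: (enum 'I_n) => // i l IH.
by rewrite D_cons inE.
Qed.

(** * Generation of the group by horizontal elements *)

Lemma Fn_ind (P : E * E -> Prop) :
  P Fone ->
  (forall p i (s : R), inFn p -> P p -> P (Fmul p (ex (s *: e i)))) ->
  forall p, inFn p -> P p.
Proof.
move=> P1 PS.
(* Right multiplication by q preserves P; such q are closed under products. *)
pose Gen q := inFn q /\ forall p, inFn p -> P p -> P (Fmul p q).
have GenM p q : Gen p -> Gen q -> Gen (Fmul p q).
  move=> [hp Gp] [hq Gq]; split; first exact: inFn_mul.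
  by move=> r hr Pr; rewrite -FmulA; apply: Gq; [exact: inFn_mul | exact: Gp].
have Gen1 : Gen Fone by split; [exact: inFn1 | move=> p _; rewrite Fmulp1].
have hd i : homog 1 (e i) := @homog_dx R n i.
have Gen_ex i s : Gen (ex (s *: e i)).
  split; first by apply/inFn_ex/homogZ.
  by move=> p hp Pp; apply: PS.
have Gen_vert x : homog 2 x -> Gen (0, x).
  move=> hx; rewrite [x]ext_dxs; apply: (big_ind (fun y => Gen (0, y))) => //.
    move=> y z Gy Gz; have := GenM _ _ Gy Gz.
    by rewrite FmulE /= mul0r !addr0.
  move=> A _; have [cA|/eqP nA] := boolP (#|A| == 2); last first.
    by rewrite hx // scale0r.
  case/cards2P: cA => i [j [nij ->]]; set c := x _.
  (* The commutator of exp(a e_i) and exp(e_j) is (0, 2a e_i e_j), which explains the c / 2; the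
     sign comes from [dxs2]. *)
  have -> : (0, c *: dxs R [set i; j]) = Fmul (Fmul (Fmul
      (ex ((c / 2 * ws [set i] [set j]) *: e i)) (ex (1 *: e j)))
      (ex ((- (c / 2 * ws [set i] [set j])) *: e i))) (ex ((- 1) *: e j)).
    rewrite dxs2 // !FmulE /= !(mulrDl, mulrDr, scalerDr, addr0).
    rewrite -!(scalerAl, scalerAr) !sqr1 // (anticomm1 (hd j) (hd i)).
    by congr pair; apply/ffunP=> S; rewrite !extlE; field.
  by do 3!apply: (GenM) => //.
have Gen_hor x : homog 1 x -> exists y, Gen (x, y).
  move=> hx; rewrite [x]homog1E //.
  apply: (big_ind (fun z => exists y, Gen (z, y))); first by exists 0.
    move=> a b [a' Ga] [b' Gb]; have := GenM _ _ Ga Gb; rewrite FmulE /= => G.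
    by exists (a' + b' + a * b).
  by move=> i _; exists 0; exact: Gen_ex.
(* The horizontal part is reached with an uncontrolled vertical part [y], which a vertical factor
   then corrects. *)
move=> [th om] [/= h1 h2]; have [y Gy] := Gen_hor _ h1.
have hy : homog 2 y by case: Gy => -[].
have G2 : Gen (0, om - y).
  by apply: Gen_vert; apply: homogD => //; exact: homogN.
have [_ /(_ Fone inFn1 P1)] := GenM _ _ Gy G2.
by rewrite Fmul1p FmulE /= mulr0 !addr0 addrC subrK.
Qed.

(** * Exponentials of 2-forms and the map [Phi] *)

(* On 2-forms the omitted terms of the exponential series vanish. *)
Definition eexp x : E := \sum_(k < n./2.+1) (k`!%:R : R)^-1 *: x ^+ k.

Definition Phi p : E := (1 + p.1) * eexp p.2.

Lemma expD_sqr0 x y k : GRing.comm x y -> y * y = 0 ->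
  (x + y) ^+ k.+1 = x ^+ k.+1 + (x ^+ k * y) *+ k.+1.
Proof.
move=> cxy yy; elim: k => [|k IH]; first by rewrite !expr1 expr0 mul1r.
rewrite exprSr IH mulrDl !mulrDr -exprSr !mulrnAl -!(mulrA (x ^+ k)) yy.
by rewrite mulr0 mul0rn addr0 -cxy mulrA -exprSr -addrA -mulrS.
Qed.

(** As x and y commute and y has square zero, this is exp (x + y) = exp x exp y with exp y = 1 +
    y. *)
Lemma eexpD_sqr0 x y : homog 2 x -> homog 2 y -> y * y = 0 ->
  eexp (x + y) = eexp x * (1 + y).
Proof.
move=> hx hy yy; rewrite mulrDr mulr1 /eexp.
rewrite big_ord_recl [in X in _ = X + _]big_ord_recl.
rewrite [in X in _ = _ + X]big_ord_recr /= -!addrA; congr (_ + _).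
(* The last term times y has degree 2 * n./2 + 2 > n. *)
have -> : (\sum_(k < n./2) k`!%:R^-1 *: x ^+ k + n./2`!%:R^-1 *: x ^+ n./2) * y
    = \sum_(k < n./2) k`!%:R^-1 *: x ^+ k * y.
  rewrite mulrDl -scalerAl mulr_suml.
  rewrite (homog_gt _ (homogM (homogX (m := n./2) hx) hy)).
    by rewrite scaler0 addr0.
  by have := odd_double_half n; lia.
rewrite -big_split /=; apply: eq_bigr => k _.
rewrite /bump /= expD_sqr0 //; last exact: comm_homog2.
rewrite scalerDr; congr (_ + _).
rewrite -scalerAl -scaler_nat scalerA factS natrM; congr (_ *: _).
by rewrite invfM mulrAC mulVf ?mul1r // pnatr_eq0.
Qed.

Lemma eexp_comm x v : homog 2 x -> homog 1 v -> GRing.comm v (eexp x).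
Proof.
move=> hx hv; apply: commr_sum => k _.
rewrite /GRing.comm -scalerAl -scalerAr; congr (_ *: _).
by apply: commrX; exact: comm_homog2_1.
Qed.

(** Write theta for [p.1]. The exponential gains the factor 1 + theta v, and (1 + theta + v) (1 +
    theta v) = (1 + theta) (1 + v) since theta and v have square zero and anticommute. *)
Lemma Phi_ex p v : inFn p -> homog 1 v -> Phi (Fmul p (ex v)) = Phi p * (1 + v).
Proof.
move=> [h1 h2] hv; rewrite /Phi FmulE /= addr0.
have h12 := homogM h1 hv.
have a := anticomm1 hv h1.
rewrite eexpD_sqr0 //; last first.
  by rewrite -mulrA (mulrA v) a mulNr -(mulrA _ v) sqr1 // mulr0 oppr0 mulr0.
have c z : homog 1 z -> (1 + z) * eexp p.2 = eexp p.2 * (1 + z).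
  by move=> hz; rewrite mulrDl mulrDr mul1r mulr1 (eexp_comm h2 hz).
rewrite mulrA c; last exact: homogD.
rewrite c // -!mulrA; congr (_ * _).
have ttv : p.1 * (p.1 * v) = 0 by rewrite mulrA sqr1 // mul0r.
have vtv : v * (p.1 * v) = 0.
  by rewrite mulrA a mulNr -mulrA sqr1 // mulr0 oppr0.
rewrite !(mulrDl, mulrDr, mulr1, mul1r) ttv vtv.
by apply/ffunP=> S; rewrite !extlE; ring.
Qed.

Lemma Phi1 : Phi Fone = 1.
Proof.
rewrite /Phi /= addr0 mul1r /eexp big_ord_recl big1 => [|k _].
  by rewrite expr0 fact0 invr1 scale1r addr0.
by rewrite /= exprS mul0r scaler0.
Qed.

Lemma h_affine_T f p : h_affine f -> inFn p -> f p = T f (Phi p).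
Proof.
(* f is generalized because the induction hypothesis is applied to both f and [X (e i) f]. *)
move=> hf hp; move: f hf; elim/Fn_ind: p / hp => [f _|p i s hp IH f hf].
  by rewrite Phi1 T1.
have hd : homog 1 (e i) by exact: homog_dx.
rewrite Phi_ex //; last exact: homogZ.
have hX := h_affineX hf hd.
rewrite mulrDr mulr1 -scalerAr addrC T_lin -T_X // -!IH //.
by rewrite h_affine_line // addrC.
Qed.

Definition lin_form (L : E -> R) :=
  forall (a : R) x y, L (a *: x + y) = a * L x + L y.

(** Dual form of the fact that the values of [Phi] span. If L vanishes on them, so does x |-> L (x *
    e i), since Phi p * e i is the difference of two of them; the induction removes the largest
    index of S. *)
Lemma Phi_total (L : E -> R) : lin_form L ->
  (forall p, inFn p -> L (Phi p) = 0) -> forall S, L (dxs R S) = 0.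
Proof.
move=> + + S; move: {2}#|S| (erefl #|S|) => m.
elim: m S L => [|m IH] S L cS linL L0.
  move/cards0_eq: cS => ->; rewrite dxs0 -Phi1 L0 //; exact: inFn1.
have [i0 i0S] : exists i, i \in S by apply/set0Pn; rewrite -card_gt0 cS.
pose i := [arg max_(k > i0 in S) (k : nat)].
have [iS maxi] : i \in S /\ forall k, k \in S -> (k <= i)%N.
  by rewrite /i; case: arg_maxnP.
rewrite (dxs_max _ iS maxi).
apply: (IH (S :\ i) (fun x => L (x * e i))).
- by have := cardsD1 i S; rewrite iS cS => -[].
- by move=> a x y; rewrite mulrDl -scalerAl linL.
move=> p hp; have hd : homog 1 (e i) by exact: homog_dx.
have := L0 _ (inFn_mulex hp hd).
rewrite Phi_ex // mulrDr mulr1 addrC -[_ * e i]scale1r linL L0 //.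
by rewrite mul1r addr0 scale1r.
Qed.

End HorizontallyAffine.

(** * Representation by the forms [eta] through Hodge duality *)

Section Representation.
Variables (R : realType) (n : nat).
Local Notation E := (ext R n).
Local Notation ws := (@wsign R n).
Implicit Types (x y theta omega : E) (S : {set 'I_n}).
Implicit Types (eta : nat -> E) (f : E * E -> R).

(* The coefficient of [vol] in the sum of the [x_m /\ eta_(n-m)], [x_m] being the
   part of degree [m] of [x], with the factorials that cancel those of [eexp]. *)
Definition etaform eta x : R :=
  \sum_(S : {set 'I_n})
    (#|S|./2)`!%:R * (ws S (~: S) * x S * eta (n - #|S|)%N (~: S)).

Lemma etaform_lin eta : lin_form (etaform eta).
Proof.
move=> a x y; rewrite /etaform mulr_sumr -big_split; apply: eq_bigr => S _ /=.
by rewrite !extlE; ring.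
Qed.

Lemma etaform_sum eta (I : Type) (r : seq I) (F : I -> E) :
  etaform eta (\sum_(k <- r) F k) = \sum_(k <- r) etaform eta (F k).
Proof.
elim/big_rec2: _ => [|k _ x _ <-].
  by rewrite /etaform big1 // => S _; rewrite ext0 mulr0 mul0r mulr0.
by rewrite -[in LHS](scale1r (F k)) etaform_lin mul1r.
Qed.

Lemma etaformZ eta (a : R) x : etaform eta (a *: x) = a * etaform eta x.
Proof.
rewrite /etaform mulr_sumr; apply: eq_bigr => S _.
by rewrite extZ; ring.
Qed.

Lemma etaform_dxs eta S : etaform eta (dxs R S) =
  (#|S|./2)`!%:R * (ws S (~: S) * eta (n - #|S|)%N (~: S)).
Proof.
rewrite /etaform (bigD1 S) //= big1 => [|A nA]; last first.
  by rewrite dxsE (negbTE nA) mulr0 mul0r mulr0.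
by rewrite dxsE eqxx mulr1 addr0.
Qed.

Lemma fact_neq0 k : (k`!%:R : R) != 0.
Proof. by rewrite pnatr_eq0 -lt0n fact_gt0. Qed.

Lemma wsign_neq0 (A B : {set 'I_n}) : ws A B != 0.
Proof. by rewrite /wsign signr_eq0. Qed.

(** A form of degree n is its coefficient at the full set times [vol], and that coefficient pairs
    each S of size m with its complement. The factorial in [etaform] is divided out. *)
Lemma homog_wedge_eta eta m x : is_eta eta -> (m <= n)%N -> homog m x ->
  x * eta (n - m)%N = ((m./2)`!%:R^-1 * etaform eta x) *: vol R n.
Proof.
move=> heta mn hx; have he := heta _ (leq_subr m n).
rewrite [LHS]vol_homog; last by have := homogM hx he; rewrite subnKC.
congr (_ *: _); rewrite [LHS]ffunE /etaform mulr_sumr.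
apply: eq_big => [S|S _]; first by rewrite subsetT.
rewrite setTD; have [<-|/eqP nS] := eqVneq #|S| m.
  by rewrite mulKf ?fact_neq0.
by rewrite hx //; ring.
Qed.

Lemma homog_even theta omega k :
  inFn (theta, omega) -> homog (2 * k) (omega ^+ k : E).
Proof. by move=> [_ h2]; exact: homogX. Qed.

Lemma homog_odd theta omega k :
  inFn (theta, omega) -> homog (2 * k + 1) (theta * omega ^+ k : E).
Proof.
by move=> [h1 h2]; rewrite addnC; apply: homogM => //; exact: homogX.
Qed.

Lemma Phi_sum theta omega : inFn (theta, omega) ->
  Phi (theta, omega) =
  \sum_(k < n./2.+1) (k`!%:R : R)^-1 *: omega ^+ k
  + \sum_(k < (n - 1)./2.+1) (k`!%:R : R)^-1 *: (theta * omega ^+ k).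
Proof.
move=> hp; rewrite /Phi mulrDl mul1r /=; congr (_ + _).
rewrite /eexp mulr_sumr; under [LHS]eq_bigr => k _ do rewrite -scalerAr.
have [e1|e1] :
  n./2 = (n - 1)./2 \/ n./2 = (n - 1)./2.+1 /\ (n < 2 * n./2 + 1)%N.
- by lia.
- by rewrite e1.
(* Here n is even and positive, and the extra term theta omega^(n/2) has degree n + 1. *)
case: e1 => e1 lt; rewrite [in LHS]e1 big_ord_recr /= -e1.
by rewrite (homog_gt lt (homog_odd hp)) scaler0 addr0.
Qed.

Lemma half_even k : (2 * k)./2 = k. Proof. by lia. Qed.
Lemma half_odd k : (2 * k + 1)./2 = k. Proof. by lia. Qed.

Lemma wedge_even eta theta omega k : is_eta eta -> inFn (theta, omega) ->
  (k <= n./2)%N ->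
  wedge (wpow omega k) (eta (n - 2 * k)%N) =
  (k`!%:R^-1 * etaform eta (omega ^+ k)) *: vol R n.
Proof.
move=> heta hp hk; have kn : (2 * k <= n)%N by lia.
have := homog_wedge_eta heta kn (homog_even hp).
by rewrite half_even wpowE.
Qed.

Lemma wedge_odd eta theta omega k : (0 < n)%N -> is_eta eta ->
  inFn (theta, omega) -> (k <= (n - 1)./2)%N ->
  wedge theta (wedge (wpow omega k) (eta (n - 2 * k - 1)%N)) =
  (k`!%:R^-1 * etaform eta (theta * omega ^+ k)) *: vol R n.
Proof.
move=> n0 heta hp hk; have kn : (2 * k + 1 <= n)%N by lia.
have := homog_wedge_eta heta kn (homog_odd hp).
by rewrite half_odd wpowE wedgeA -subnDA.
Qed.

Lemma vol_inj : injective (fun a : R => a *: vol R n).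
Proof. by move=> a b /ffunP/(_ setT); rewrite !extZ ffunE eqxx !mulr1. Qed.

(** The factors 1 / k! produced by [wedge_even] and [wedge_odd] are exactly the coefficients in
    [Phi_sum]. *)
Lemma representsP f eta : (0 < n)%N -> is_eta eta ->
  represents f eta <-> forall p, inFn p -> f p = etaform eta (Phi p).
Proof.
move=> n0 heta.
have main theta omega : inFn (theta, omega) ->
    eadd (esum (n./2).+1 (fun k => wedge (wpow omega k) (eta (n - 2 * k)%N)))
         (esum ((n - 1)./2).+1
            (fun k =>
               wedge theta (wedge (wpow omega k) (eta (n - 2 * k - 1)%N))))
    = etaform eta (Phi (theta, omega)) *: vol R n.
  move=> hp; rewrite Phi_sum // -[X in etaform _ (X + _)]scale1r etaform_lin.
  rewrite mul1r !etaform_sum scalerDl !scaler_suml !esumE.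
  congr (_ + _); apply: eq_bigr => k _; rewrite etaformZ.
    by rewrite (wedge_even heta hp) // -ltnS.
  by rewrite (wedge_odd n0 heta hp) // -ltnS.
split=> [hrep [theta omega] hp|hrep theta omega hp].
  by apply: vol_inj; rewrite -main //; exact: hrep.
by rewrite main // hrep.
Qed.

(** Hodge duality: the coefficient of x at S is paired only with that of eta at the complement, with
    a nonzero weight, so dividing by the weights gives eta. *)
Lemma etaform_surj (c : {set 'I_n} -> R) :
  exists eta, is_eta eta /\ forall x, etaform eta x = \sum_S x S * c S.
Proof.
exists (fun m => [ffun S : {set 'I_n} => if #|S| == m then
  ((#|~: S|./2)`!%:R * ws (~: S) S)^-1 * c (~: S) else 0]).
split=> [k _ S /eqP/negbTE nS|x]; first by rewrite ffunE nS.
apply: eq_bigr => S _; rewrite ffunE setCK.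
have -> : (n - #|S|)%N = #|~: S| by have := cardsC S; rewrite card_ord; lia.
rewrite eqxx.
have := fact_neq0 #|S|./2; have := wsign_neq0 S (~: S).
by move=> ? ?; field; apply/andP.
Qed.

Lemma represents_h_affine f eta : (0 < n)%N -> is_eta eta ->
  represents f eta -> h_affine f.
Proof.
move=> n0 heta /(representsP _ n0 heta) hf p v hp hv.
(* By [Phi_ex], Phi (p exp(tv)) = Phi p + t Phi p v. *)
exists (etaform eta (Phi p * v)), (etaform eta (Phi p)) => t.
rewrite -[(escale t v, _)]/(ex (t *: v)).
have htv : homog 1 (t *: v) by exact: homogZ.
rewrite hf ?Phi_ex //; last exact: inFn_mulex.
by rewrite mulrDr mulr1 -scalerAr addrC etaform_lin [t * _]mulrC.
Qed.

Lemma h_affine_represents f : (0 < n)%N -> h_affine f ->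
  exists eta, is_eta eta /\ represents f eta.
Proof.
move=> n0 hf.
have [eta [heta L]] := etaform_surj (fun S => D f (enum 'I_n) S (Fone R n)).
exists eta; split => //; apply/representsP => // p hp.
by rewrite L; exact: h_affine_T.
Qed.

(** By [Phi_total] the two functionals agree on every monomial, and the value at [dxs (~: S)] is a
    nonzero multiple of the coefficient of [eta k] at S, where k is the size of S. *)
Lemma represents_inj f eta eta' : (0 < n)%N -> is_eta eta -> represents f eta ->
  is_eta eta' -> represents f eta' -> forall k, (k <= n)%N -> eta k = eta' k.
Proof.
move=> n0 h /(representsP _ n0 h) r h' /(representsP _ n0 h') r' k kn.
apply/ffunP=> S; have [cS|/eqP nS] := eqVneq #|S| k; last first.
  by rewrite (h _ kn _ nS) (h' _ kn _ nS).
have linB : lin_form (fun x => etaform eta x - etaform eta' x).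
  by move=> a x y; rewrite !etaform_lin; ring.
have B0 p : inFn p -> etaform eta (Phi p) - etaform eta' (Phi p) = 0.
  by move=> hp; rewrite -r // -r' // subrr.
have := Phi_total linB B0 (~: S).
rewrite !etaform_dxs setCK (_ : (n - #|~: S|)%N = k); last first.
  by have := cardsC S; rewrite card_ord cS; lia.
move/eqP; rewrite subr_eq0 => /eqP H.
by apply: (mulfI (wsign_neq0 (~: S) S)); apply: (mulfI (fact_neq0 #|~: S|./2)).
Qed.

(** * Expansion along dilations *)

Lemma sum_parity (F : nat -> R) m :
  \sum_(k < m.+1) F k =
  \sum_(k < m./2.+1) F (2 * k)%N + \sum_(k < m.+1./2) F (2 * k + 1)%N.
Proof.
elim: m => [|m IH]; first by rewrite !big_ord_recl !big_ord0 !addr0.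
rewrite big_ord_recr IH /=; have [om|em] := boolP (odd m).
  have -> : uphalf m = m./2.+1 by lia.
  rewrite [X in _ = X + _]big_ord_recr /= addrAC; congr (_ + F _ + _).
  by lia.
have -> : uphalf m = m./2 by lia.
rewrite [X in _ = _ + X]big_ord_recr /= -addrA; congr (_ + (_ + F _)).
by lia.
Qed.

(** Dilation by t multiplies the part of degree m of [Phi] by t^m, so the coefficient of index m is
    [etaform eta] on that part. *)
Lemma represents_dil f eta theta omega : (0 < n)%N -> is_eta eta ->
  represents f eta -> inFn (theta, omega) ->
  exists p : {poly R},
    [/\ (size p <= n.+1)%N, forall t : R, f (dil t (theta, omega)) = p.[t],
     forall k, (k <= n./2)%N ->
         p`_(2 * k) = k`!%:R^-1 * etaform eta (omega ^+ k)
     & forall k, (k <= (n - 1)./2)%N ->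
         p`_(2 * k + 1) = k`!%:R^-1 * etaform eta (theta * omega ^+ k)].
Proof.
move=> n0 heta /(representsP _ n0 heta) hf hp; have [h1 h2] := hp.
pose c m : R := (m./2)`!%:R^-1 *
  etaform eta (if odd m then theta * omega ^+ m./2 else omega ^+ m./2).
exists (\poly_(m < n.+1) c m); split.
- exact: size_poly.
- move=> t; rewrite -[dil _ _]/(t *: theta, t ^+ 2 *: omega).
  have hd : inFn (t *: theta, t ^+ 2 *: omega) by split; exact: homogZ.
  rewrite hf //.
  rewrite Phi_sum // -[X in etaform _ (X + _)]scale1r etaform_lin mul1r.
  rewrite !etaform_sum horner_poly.
  rewrite (sum_parity (fun m => c m * t ^+ m)).
  (* Both count the odd numbers up to n; as subtraction is truncated, this relies on n > 0. *)
  have -> : n.+1./2 = (n - 1)./2.+1 by lia.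
  congr (_ + _); apply: eq_bigr => k _; rewrite etaformZ /c.
    rewrite half_even (_ : odd (2 * k) = false); last by lia.
    by rewrite exprZn -exprM etaformZ; ring.
  rewrite half_odd (_ : odd (2 * k + 1) = true); last by lia.
  rewrite exprZn -exprM -scalerAl -scalerAr scalerA etaformZ addn1 exprS.
  by ring.
- move=> k hk; rewrite coef_poly ltnS (_ : (2 * k <= n)%N); last by lia.
  by rewrite /c half_even (_ : odd (2 * k) = false) //; lia.
- move=> k hk; rewrite coef_poly ltnS (_ : (2 * k + 1 <= n)%N); last by lia.
  by rewrite /c half_odd (_ : odd (2 * k + 1) = true) //; lia.
Qed.

End Representation.

Theorem theorem1p1 (R : realType) (n : nat) (hn : (2 <= n)%N) :
  (forall f : ext R n * ext R n -> R,
     h_affine f <-> exists eta : nat -> ext R n, is_eta eta /\ represents f eta)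
  /\ (forall (f : ext R n * ext R n -> R) (eta eta' : nat -> ext R n),
        is_eta eta -> represents f eta -> is_eta eta' -> represents f eta' ->
        forall k, (k <= n)%N -> eta k = eta' k)
  /\ (forall (f : ext R n * ext R n -> R) (eta : nat -> ext R n),
        h_affine f -> is_eta eta -> represents f eta ->
        forall theta omega, inFn (theta, omega) ->
        exists p : {poly R},
          (size p <= n.+1)%N
          /\ (forall t : R, 0 < t -> f (dil t (theta, omega)) = p.[t])
          /\ (forall k, (k <= n./2)%N ->
                wedge (wpow omega k) (eta (n - 2 * k)%N)
                = escale (p^`N(2 * k)).[0] (vol R n))
          /\ (forall k, (k <= (n - 1)./2)%N ->
                wedge theta (wedge (wpow omega k) (eta (n - 2 * k - 1)%N))
                = escale (p^`N(2 * k + 1)).[0] (vol R n))).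
Proof.
have n0 : (0 < n)%N by exact: ltnW.
(* The normalized derivative of order m includes the factor 1 / m!. *)
have nderivn0 (p : {poly R}) m : (p^`N(m)).[0] = p`_m.
  by rewrite horner_coef0 coef_nderivn addn0 binn mulr1n.
split=> [f|]; first split.
- exact: h_affine_represents.
- by move=> [eta [heta]]; exact: represents_h_affine.
split=> [f eta eta'|f eta _ heta hrep theta omega hp]; first exact: represents_inj.
have [p [sp hp' pe po]] := represents_dil n0 heta hrep hp.
exists p; split=> //; split=> [t _|]; first exact: hp'.
split=> k hk; rewrite nderivn0.
- by rewrite pe //; exact: wedge_even hp hk.
- by rewrite po //; exact: wedge_odd hp hk.
Qed.
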